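(* Let $\mathcal{H}$ be a finite-dimensional complex Hilbert space and let $\{(\mathcal{I}_\omega,\mathcal{C}_\omega)\}_{\omega\in\Omega}$ be an ex-ante-ex-post control protocol on $\mathcal{H}$. Then the set of all noise processes (TPCP maps) $\mathcal{N}:\mathcal{L}(\mathcal{H})\to\mathcal{L}(\mathcal{H})$ that are optimally suppressed by $\{(\mathcal{I}_\omega,\mathcal{C}_\omega)\}_{\omega\in\Omega}$ is convex.
   Context: $\mathcal{L}(\mathcal{H})$ is the space of linear operators on the finite-dimensional complex Hilbert space $\mathcal{H}$. TPCP means trace-preserving and completely positive. A noise process is a TPCP map $\mathcal{N}:\mathcal{L}(\mathcal{H})\to\mathcal{L}(\mathcal{H})$. An ex-ante-ex-post control protocol is a family $\{(\mathcal{I}_\omega,\mathcal{C}_\omega)\}_{\omega\in\Omega}$ indexed by a finite set $\Omega$ (arbitrary, depending on the protocol), where each $\mathcal{I}_\omega:\mathcal{L}(\mathcal{H})\to\mathcal{L}(\mathcal{H})$ is completely positive, $\sum_{\omega\in\Omega}\mathcal{I}_\omega$ is trace-preserving (i.e. $\{\mathcal{I}_\omega\}$ is a CP instrument), and each $\mathcal{C}_\omega:\mathcal{L}(\mathcal{H})\to\mathcal{L}(\mathcal{H})$ is TPCP. The average operation of the protocol for noise $\mathcal{N}$ is $\mathcal{E}=\sum_{\omega\in\Omega}\mathcal{C}_\omega\circ\mathcal{N}\circ\mathcal{I}_\omega$, and its average fidelity is $$\bar F=\int_{\|\psi\|=1}\langle\psi|\,\mathcal{E}(|\psi\rangle\langle\psi|)\,|\psi\rangle\,d\psi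 ,$$ where $d\psi$ is the normalized uniform (unitarily invariant) probability measure on the unit sphere of $\mathcal{H}$. A protocol optimally suppresses $\mathcal{N}$ (is optimal for $\mathcal{N}$) if its average fidelity for $\mathcal{N}$ is greater than or equal to that of every ex-ante-ex-post control protocol for the same $\mathcal{N}$. *)

(* Defs.v *)
From HB Require Import structures.
From mathcomp Require Import all_boot all_order all_algebra.
From mathcomp Require Import complex.
From mathcomp Require Import all_classical all_reals all_analysis.

Set Implicit Arguments.
Unset Strict Implicit.
Unset Printing Implicit Defensive.

Import Order.TTheory GRing.Theory Num.Theory.
Import numFieldNormedType.Exports.

Local Open Scope classical_set_scope.
Local Open Scope sesquilinear_scope.
Local Open Scope ring_scope.

(* The Hilbert space H is C^n: kets are column vectors, <phi|psi> is
   (phi ^t* *m psi) 0 0, and L(H) is 'M[C]_n. *)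

Section Protocols.
Context (R : realType).

Local Notation C := R[i].

Definition superop (n : nat) : vectType C := 'End('M[C]_n).

(* Over C, 0 <= z means that z is real and nonnegative, so psdmx A entails
   that A is Hermitian. *)
Definition psdmx (m : nat) (A : 'M[C]_m) : Prop :=
  forall v : 'cV[C]_m, 0 <= (v ^t* *m A *m v) 0 0.

(* id_k (x) Phi on L(C^k (x) H), whose elements are k x k block matrices with
   blocks in L(H). *)
Definition ampliation (n k : nat) (Phi : superop n)
    (X : 'M[C]_(\sum_(i < k) n)) : 'M[C]_(\sum_(i < k) n) :=
  \mxblock_(i < k, j < k) Phi (submxblock X i j).

Definition completely_positive (n : nat) (Phi : superop n) : Prop :=
  forall (k : nat) (X : 'M[C]_(\sum_(i < k) n)),
    psdmx X -> psdmx (ampliation Phi X).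

Definition trace_preserving (n : nat) (Phi : superop n) : Prop :=
  forall X : 'M[C]_n, \tr (Phi X) = \tr X.

Definition TPCP (n : nat) (Phi : superop n) : Prop :=
  trace_preserving Phi /\ completely_positive Phi.

Record protocol (n : nat) := Protocol {
  outcome : finType;
  instrument : outcome -> superop n;
  control : outcome -> superop n;
  instrument_cp : forall w, completely_positive (instrument w);
  instrument_tp : trace_preserving (\sum_w instrument w);
  control_tpcp : forall w, TPCP (control w)
}.

Definition average_op (n : nat) (P : protocol n) (N : superop n) : superop n :=
  \sum_(w : outcome P) (control w \o N \o instrument w)%VF.

(* The Hilbert norm is meant here; the library's `|psi| on matrices is the sup
   norm. *)
Definition unit_sphere (n : nat) : set 'cV[C]_n :=
  [set psi | (psi ^t* *m psi) 0 0 = 1].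
Arguments unit_sphere : clear implicits.

(* C^n with its Borel sigma-algebra.  The library's metric topology on C is
   found through numClosedFieldType. *)
Definition borel_cV (n : nat) : measurableType _ :=
  g_sigma_algebraType (@open 'cV[(C : numClosedFieldType)]_n).

(* The uniform measure on the unit sphere is represented as a probability on
   C^n concentrated on the sphere; unitary invariance determines it.  For
   n = 0 the sphere is empty and there is no such measure. *)
Definition uniform_on_sphere (n : nat) (mu : probability (borel_cV n) R)
    : Prop :=
  mu (unit_sphere n) = 1%E /\
  forall U : 'M[C]_n, U \is unitarymx ->
    forall A : set (borel_cV n), measurable A ->
      mu ((fun psi : 'cV[C]_n => U *m psi) @^-1` A) = mu A.

(* <psi|E(|psi><psi|)|psi> is real because E is positive; Re only changes its
   type. *)
Definition average_fidelity (n : nat) (mu : probability (borel_cV n) R)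
    (P : protocol n) (N : superop n) : \bar R :=
  (\int[mu]_(psi in unit_sphere n)
     (complex.Re
        ((psi ^t* *m average_op P N (psi *m psi ^t*) *m psi) 0 0))%:E)%E.

Definition optimally_suppresses (n : nat) (mu : probability (borel_cV n) R)
    (P : protocol n) (N : superop n) : Prop :=
  forall Q : protocol n,
    (average_fidelity mu Q N <= average_fidelity mu P N)%E.

(* convex_lmodType makes convex_set applicable; its coefficients range over
   {i01 C}, i.e. over the real interval [0, 1] seen in C. *)
Definition suppressed_noise (n : nat) (mu : probability (borel_cV n) R)
    (P : protocol n) : set (convex_lmodType (superop n)) :=
  [set N | TPCP N /\ optimally_suppresses mu P N].

End Protocols.

(* Main.v *)
(** The average fidelity of a protocol is affine in the noise, so an inequality
    between the fidelities of two protocols that holds for two noises also holds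
    for their mixtures.  Integrals split along a sum only for integrable
    functions; here the integrand is a polynomial in the coordinates of psi and
    their conjugates, hence continuous, and bounded on the unit sphere. *)

Require Import Defs.
From mathcomp Require Import all_boot all_order all_algebra.
From mathcomp Require Import complex.
From mathcomp Require Import all_classical all_reals all_analysis.

Set Implicit Arguments.
Unset Strict Implicit.
Unset Printing Implicit Defensive.

Import Order.TTheory GRing.Theory Num.Theory.
Import numFieldNormedType.Exports.

Local Open Scope classical_set_scope.
Local Open Scope sesquilinear_scope.
Local Open Scope ring_scope.

Section ContinuousBounded.
Context {C : numClosedFieldType} {T : topologicalType}.
Variable S : set T.
Implicit Types f g : T -> C.

Lemma conj_continuous : continuous (@Num.conj C : C -> C).
Proof.
move=> z A /= /nbhs_ballP[e /= e0 eA].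
apply/nbhs_ballP; exists e => [//|w zw].
by apply: eA; rewrite /ball/= -rmorphB norm_conjC.
Qed.

(** Continuity is asked on all of [T] and later gives Borel measurability; the bound is asked only
    on [S], because the coordinates of a vector are unbounded off the sphere. *)
Definition continuous_bounded f :=
  continuous f /\ exists M : C, forall x, S x -> `|f x| <= M.

Lemma continuous_bounded_cst c : continuous_bounded (fun=> c).
Proof. by split; [move=> x; exact: cvg_cst|exists `|c|]. Qed.

Lemma continuous_boundedD f g :
  continuous_bounded f -> continuous_bounded g ->
  continuous_bounded (fun x => f x + g x).
Proof.
move=> [cf [M fM]] [cg [N gN]]; split.
  by move=> x; apply: cvgD; [exact: cf|exact: cg].
by exists (M + N) => x Sx; rewrite (le_trans (ler_normD _ _))// lerD ?fM ?gN.
Qed.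

Lemma continuous_boundedM f g :
  continuous_bounded f -> continuous_bounded g ->
  continuous_bounded (fun x => f x * g x).
Proof.
move=> [cf [M fM]] [cg [N gN]]; split.
  by move=> x; apply: cvgM; [exact: cf|exact: cg].
by exists (M * N) => x Sx; rewrite normrM ler_pM ?fM ?gN.
Qed.

Lemma continuous_bounded_sum I (r : seq I) (f : I -> T -> C) :
  (forall i, continuous_bounded (f i)) ->
  continuous_bounded (fun x => \sum_(i <- r) f i x).
Proof.
move=> cf; elim: r => [|i r IH].
  rewrite (_ : (fun _ => _) = fun=> 0); first exact: continuous_bounded_cst.
  by apply/funext => x; rewrite big_nil.
rewrite (_ : (fun _ => _) = fun x => f i x + \sum_(i <- r) f i x).
  exact: continuous_boundedD.
by apply/funext => x; rewrite big_cons.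
Qed.

Lemma continuous_bounded_conj f :
  continuous_bounded f -> continuous_bounded (fun x => (f x)^*).
Proof.
move=> [cf [M fM]]; split.
  by move=> x; apply: continuous_comp; [exact: cf|exact: conj_continuous].
by exists M => x Sx; rewrite norm_conjC fM.
Qed.

End ContinuousBounded.

Section Fidelity.
Variable R : realType.

(* The topology on R[i] is only found through numClosedFieldType. *)
Local Notation C := (R[i] : numClosedFieldType).
Local Notation S n := (@unit_sphere R n : set 'cV[C]_n).

Lemma Re_continuous : continuous (@complex.Re R : C -> R).
Proof.
move=> z A /= /nbhs_ballP[e /= e0 eA].
(* Balls of [C] have radii in [C], so the real radius [e] is embedded; it suffices because the real
   part is 1-Lipschitz. *)
apply/(@nbhs_ballP C); exists e%:C%C => [|w zw]; first by rewrite /= ltcR.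
by apply: eA; rewrite /ball/= -raddfB -ltcR (le_lt_trans (normc_ge_Re _)).
Qed.

(** On the sphere, the squared modulus of a coordinate is one term of a sum of nonnegative terms
    equal to 1. *)
Lemma continuous_bounded_coord n (i : 'I_n) :
  continuous_bounded (S n) (fun psi => psi i 0).
Proof.
split; first exact: coord_continuous.
exists 1 => psi; rewrite /unit_sphere /= mxE => S1.
rewrite -(@expr_le1 _ 2)// -S1 normCK (bigD1 i)//= !mxE mulrC lerDl.
by apply: sumr_ge0 => j _; rewrite !mxE mulrC mul_conjC_ge0.
Qed.

Lemma continuous_bounded_sqnorm n :
  continuous_bounded (S n) (fun psi => (psi ^t* *m psi) 0 0).
Proof.
under eq_fun do rewrite mxE.
apply: continuous_bounded_sum => i; under eq_fun do rewrite !mxE.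
apply: continuous_boundedM; last exact: continuous_bounded_coord.
exact/continuous_bounded_conj/continuous_bounded_coord.
Qed.

Lemma continuous_bounded_fidelity n (E : superop R n) :
  continuous_bounded (S n)
    (fun psi => (psi ^t* *m E (psi *m psi ^t*) *m psi) 0 0).
Proof.
(* Expanding the projector in matrix units and using linearity of [E] turns each entry into a
   polynomial in the coordinates and their conjugates, with constant coefficients. *)
have EE (psi : 'cV[C]_n) i j : E (psi *m psi ^t*) i j =
    \sum_k \sum_l psi k 0 * (psi l 0)^* * E (delta_mx k l) i j.
  rewrite [X in E X]matrix_sum_delta linear_sum summxE; apply: eq_bigr => k _.
  rewrite linear_sum summxE; apply: eq_bigr => l _.
  by rewrite linearZ !mxE big_ord1 !mxE.
have cc i := continuous_bounded_coord i.
under eq_fun do rewrite mxE.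
apply: continuous_bounded_sum => j; apply: continuous_boundedM => //.
under eq_fun do rewrite mxE.
apply: continuous_bounded_sum => i; under eq_fun do rewrite !mxE EE.
apply: continuous_boundedM; first exact: continuous_bounded_conj.
apply: continuous_bounded_sum => k; apply: continuous_bounded_sum => l.
apply: continuous_boundedM; last exact: continuous_bounded_cst.
by apply: continuous_boundedM => //; exact: continuous_bounded_conj.
Qed.

(** Open intervals generate the Borel sets of [R], and their preimages under [f] are open, hence
    among the generators of [borel_cV]. *)
Lemma continuous_measurable_cV n (f : 'cV[C]_n -> R) (D : set (borel_cV R n)) :
  measurable D -> continuous f -> measurable_fun D (f : borel_cV R n -> R).
Proof.
move=> mD /continuousP cf.
apply: (measurability _ (@measurable_realfun.RGenOpens.measurableE R)).
move=> _ [_ [a [b ->] <-]]; apply: measurableI => //.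
by apply: sub_sigma_algebra; exact/cf/interval_open.
Qed.

(** The complement is the preimage of the open set of numbers other than 1 under the continuous
    squared norm. *)
Lemma measurable_unit_sphere n :
  measurable (@unit_sphere R n : set (borel_cV R n)).
Proof.
rewrite -[X in measurable X]setCK; apply: measurableC.
apply: sub_sigma_algebra.
have /continuousP/(_ (~` [set 1])) := (continuous_bounded_sqnorm n).1; apply.
apply/closed_openC/accessible_closed_set1/hausdorff_accessible.
exact: norm_hausdorff.
Qed.

Lemma integrable_fidelity n (mu : probability (borel_cV R n) R)
    (E : superop R n) :
  mu.-integrable (@unit_sphere R n) (fun psi =>
    (complex.Re ((psi ^t* *m E (psi *m psi ^t*) *m psi) 0 0))%:E).
Proof.
have mS := @measurable_unit_sphere n.
have [cE [M EM]] := continuous_bounded_fidelity E.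
apply: measurable_bounded_integrable => //.
- by rewrite (le_lt_trans (probability_le1 _ _)) ?ltry.
- apply: continuous_measurable_cV => // x.
  by apply: continuous_comp; [exact: cE|exact: Re_continuous].
- exists (complex.Re M); split; first exact: num_real.
  move=> x Mx psi Spsi /=.
  (* This inequality lives in [C], where the order compares real parts and forces equal imaginary
     parts; its real half gives the bound [complex.Re M]. *)
  have := le_trans (normc_ge_Re _) (EM _ Spsi).
  by rewrite lecE /= => /andP[_ /le_trans]; apply; exact: ltW.
Qed.

End Fidelity.

Section Mixtures.
Variable R : realType.
Local Notation C := R[i].

Lemma quadratic_form_comb m (a b : C) (A B : 'M[C]_m) (v : 'cV[C]_m) :
  (v ^t* *m (a *: A + b *: B) *m v) 0 0 =
  a * (v ^t* *m A *m v) 0 0 + b * (v ^t* *m B *m v) 0 0.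
Proof.
rewrite mulmxDr mulmxDl -!scalemxAr -!scalemxAl.
by rewrite mxE [X in X + _]mxE [X in _ + X]mxE.
Qed.

Lemma psdmx_comb m (a b : C) (A B : 'M[C]_m) :
  0 <= a -> 0 <= b -> psdmx A -> psdmx B -> psdmx (a *: A + b *: B).
Proof.
move=> a0 b0 pA pB v; rewrite quadratic_form_comb.
by apply: addr_ge0; apply: mulr_ge0; auto.
Qed.

Lemma TPCP_comb n (a b : C) (M N : superop R n) :
  0 <= a -> 0 <= b -> a + b = 1 ->
  TPCP M -> TPCP N -> TPCP (a *: M + b *: N).
Proof.
move=> a0 b0 ab [tM cM] [tN cN]; split => [X|k X pX].
  by rewrite add_lfunE !scale_lfunE mxtraceD !mxtraceZ tM tN -mulrDl ab mul1r.
(* Ampliation is linear in the map, so complete positivity reduces to the positive semidefinite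
   matrices forming a convex cone. *)
rewrite (_ : ampliation _ X = a *: ampliation M X + b *: ampliation N X).
  exact: psdmx_comb a0 b0 (cM k X pX) (cN k X pX).
by apply/matrixP => i j; rewrite !mxE add_lfunE !scale_lfunE !mxE.
Qed.

Lemma average_op_comb n (P : protocol R n) (a b : C) (M N : superop R n) :
  average_op P (a *: M + b *: N) = a *: average_op P M + b *: average_op P N.
Proof.
rewrite /average_op !scaler_sumr -big_split; apply: eq_bigr => w _ /=.
by rewrite comp_lfunDr comp_lfunDl -!comp_lfunZr -!comp_lfunZl.
Qed.

(** The real part is linear over [R] but not over [C], hence the embedded real coefficients. *)
Lemma Re_comb (a b : R) (z w : C) :
  complex.Re (a%:C%C * z + b%:C%C * w) = a * complex.Re z + b * complex.Re w.
Proof. by case: z w => x y [x' y'] /=; rewrite !mul0r !subr0. Qed.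

Lemma average_fidelity_comb n (mu : probability (borel_cV R n) R)
    (P : protocol R n) (a b : R) (M N : superop R n) :
  average_fidelity mu P (a%:C%C *: M + b%:C%C *: N) =
  (a%:E * average_fidelity mu P M + b%:E * average_fidelity mu P N)%E.
Proof.
have mS := @measurable_unit_sphere R n.
have iM := integrable_fidelity mu (average_op P M).
have iN := integrable_fidelity mu (average_op P N).
(* The right-hand side is gathered into a single integral, so that only the integrands remain to be
   compared. *)
rewrite /average_fidelity -(integralZl mS iM) -(integralZl mS iN).
rewrite -(integralD mS (integrableZl mS a iM) (integrableZl mS b iN)).
apply: eq_integral => psi _; rewrite average_op_comb add_lfunE !scale_lfunE.
by rewrite quadratic_form_comb Re_comb.
Qed.

End Mixtures.

Theorem proposition1 (R : realType) (n : nat)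
    (mu : probability (borel_cV R n) R) (hmu : uniform_on_sphere mu)
    (P : protocol R n) :
  convex_set (suppressed_noise mu P).
Proof.
move=> M N p /set_mem[tM oM] /set_mem[tN oN]; apply/mem_set.
(* The convexity weight is an element of [C] between 0 and 1, hence real; it is replaced by its real
   part [a] so that the fidelity splits. *)
pose a := complex.Re p%:num.
have pE : p%:num = a%:C%C by rewrite RRe_real// ger0_real.
have a0 : 0 <= a by rewrite -lecR -pE; exact: ge0.
have a1 : 0 <= 1 - a by rewrite subr_ge0 -lecR -pE; exact: le1.
have qE : 1 - p%:num = (1 - a)%:C%C by rewrite pE rmorphB.
have -> : conv p M N =
    p%:num *: (M : superop R n) + (1 - p%:num) *: (N : superop R n) by [].
rewrite qE pE; split.
  by apply: TPCP_comb; rewrite ?lecR// rmorphB subrKC.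
(* The fidelities of [Q] and [P] split with the same nonnegative weights, so optimality of [P] for
   [M] and for [N], both tested against [Q], can be combined termwise. *)
move=> Q; rewrite !average_fidelity_comb.
by apply: leeD; apply: lee_wpmul2l; rewrite ?lee_fin.
Qed.
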